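(* There exist a finite Cayley graph $G=(V,E)$ (undirected, unweighted and simple) and two vertices $u,v\in V$ such that the function $$r_{u,v}(t)=\frac{p_{u,v}(t)}{p_{u,u}(t)},\qquad t\ge 0,$$ is not monotonically non-decreasing; that is, there are $0\le t_1<t_2$ with $r_{u,v}(t_1)>r_{u,v}(t_2)$. Here $p_{u,v}(t)$ is the probability that the continuous-time random walk on $G$ started at $u$ is at $v$ at time $t$.
   Context: A finite (undirected, unweighted, simple) Cayley graph is given by a finite group $\Gamma$ and a generating set $S\subseteq\Gamma$ with $S=S^{-1}$ and $1\notin S$: its vertex set is $V=\Gamma$, and its edges are the pairs $\{x,xs\}$ with $x\in\Gamma$, $s\in S$. It is $D$-regular with $D=|S|$. For a finite $D$-regular unweighted simple graph $G=(V,E)$, the Laplacian is the $V\times V$ matrix $L$ with $L_{x,x}=1$, $L_{x,y}=-1/D$ if $\{x,y\}\in E$, and $L_{x,y}=0$ otherwise. The continuous-time random walk on $G$ has heat kernel $H_t=e^{-tL}$ for $t\ge 0$, and $p_{x,y}(t)=H_t(x,y)$ is the probability that the walk started at $x$ is at $y$ at time $t$. *)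

(* Defs.v *)
From HB Require Import structures.
From mathcomp Require Import all_boot all_order all_algebra all_fingroup.
From mathcomp Require Import all_classical all_reals all_analysis.

Set Implicit Arguments.
Unset Strict Implicit.
Unset Printing Implicit Defensive.

Import Order.TTheory GRing.Theory Num.Theory.
Import numFieldNormedType.Exports.

Local Open Scope ring_scope.

Definition simple_graph (V : finType) (E : rel V) : Prop :=
  symmetric E /\ irreflexive E.

Definition regular_graph (V : finType) (E : rel V) (D : nat) : Prop :=
  forall x : V, #|[set y : V | E x y]%SET| = D.

Definition cayley_set (gT : finGroupType) (S : {set gT}) : Prop :=
  [/\ (<<S>> = [set: gT]%SET)%g, (S^-1 = S)%g & (1 \notin S)%g].

Definition cayley_edge (gT : finGroupType) (S : {set gT}) : rel gT :=
  fun x y => [exists s in S, y == x * s]%g.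

Lemma cayley_edge_simple (gT : finGroupType) (S : {set gT}) :
  cayley_set S -> simple_graph (cayley_edge S).
Proof.
move=> [_ SV S1]; split=> [x y|x].
  have sym a b : cayley_edge S a b -> cayley_edge S b a.
    move=> /exists_inP[s sS /eqP->]; apply/exists_inP; exists (s^-1)%g.
      by rewrite -mem_invg SV.
    by rewrite mulgK.
  by apply/idP/idP; exact: sym.
apply/negbTE/exists_inP => -[s sS]; rewrite eq_sym -{2}[x]mulg1 => /eqP /mulgI s1.
by rewrite s1 (negbTE S1) in sS.
Qed.

Lemma cayley_edge_regular (gT : finGroupType) (S : {set gT}) :
  regular_graph (cayley_edge S) #|S|.
Proof.
move=> x; rewrite -(card_imset S (mulgI x)); apply: eq_card => y.
rewrite !inE; apply/exists_inP/imsetP => [[s sS /eqP->]|[s sS ->]]; by exists s.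
Qed.

(* The limit is taken in the normed space 'M[R]_n; it exists by expmx_cvg below. *)
Definition expmx (R : realType) (n : nat) (A : 'M[R]_n) : 'M[R]_n :=
  limn (series (fun k : nat => k`!%:R^-1 *: A ^+ k)).

Local Open Scope classical_set_scope.

Lemma mx_exp_entry_le (R : realType) (n : nat) (A : 'M[R]_n) (k : nat) i j :
  `|(A ^+ k) i j| <= (\sum_p \sum_q `|A p q|) ^+ k.
Proof.
elim: k i j => [|k IHk] i j.
  by rewrite !expr0 mxE; case: (i == j); rewrite ?normr1 ?normr0.
rewrite !exprS mxE (le_trans (ler_norm_sum _ _ _))//.
apply: (@le_trans _ _ (\sum_q `|A i q| * (\sum_p \sum_q `|A p q|) ^+ k)).
  by apply: ler_sum => q _; rewrite normrM ler_wpM2l.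
rewrite -mulr_suml ler_wpM2r ?exprn_ge0 ?sumr_ge0//.
  by move=> p _; rewrite sumr_ge0.
by rewrite [leRHS](bigD1 i)//= lerDl sumr_ge0// => p _; rewrite sumr_ge0.
Qed.

Lemma expmx_entry_is_cvg (R : realType) (n : nat) (A : 'M[R]_n) i j :
  cvgn (series (fun k : nat => k`!%:R^-1 * (A ^+ k) i j)).
Proof.
apply: normed_cvg; pose c : R := \sum_p \sum_q `|A p q|.
apply: (series_le_cvg _ _ _ (is_cvg_series_exp_coeff c)) => [k|k|k] /=.
- exact: normr_ge0.
  apply: exp_coeff_ge0; rewrite sumr_ge0// => p _.
  by rewrite sumr_ge0.
change (`|k`!%:R^-1 * (A ^+ k) i j| <= c ^+ k / k`!%:R).
rewrite normrM mulrC [X in _ * X]ger0_norm ?invr_ge0 ?ler0n//.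
by rewrite ler_wpM2r ?invr_ge0 ?ler0n// mx_exp_entry_le.
Qed.

Lemma expmx_cvg (R : realType) (n : nat) (A : 'M[R]_n) :
  series (fun k : nat => k`!%:R^-1 *: A ^+ k) @ \oo --> expmx A.
Proof.
rewrite /expmx; apply/cvg_ex; exists (\matrix_(i, j)
  limn (series (fun k : nat => k`!%:R^-1 * (A ^+ k) i j))).
apply/cvg_mx_entourageP => U entU.
have entry i j : \forall m \near \oo, ((\matrix_(i, j)
    limn (series (fun k : nat => k`!%:R^-1 * (A ^+ k) i j))) i j,
    (series (fun k : nat => k`!%:R^-1 *: A ^+ k) m : 'M[R]_n) i j) \in U.
  have H : \forall m \near \oo, U (limn (series (fun k : nat =>
      k`!%:R^-1 * (A ^+ k) i j)), series (fun k => k`!%:R^-1 * (A ^+ k) i j) m).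
    by have /cvg_entourageP/(_ U entU) := @expmx_entry_is_cvg R n A i j.
  apply: filterS H => m; rewrite /xsection /= !inE mxE /series /= summxE.
  by under [X in _ -> U (_, X)]eq_bigr => k _ do rewrite mxE.
have {}entry i : \forall m \near \oo, forall j, ((\matrix_(i, j)
    limn (series (fun k : nat => k`!%:R^-1 * (A ^+ k) i j))) i j,
    (series (fun k : nat => k`!%:R^-1 *: A ^+ k) m : 'M[R]_n) i j) \in U.
  exact: filter_forall (entry i).
exact: filter_forall entry.
Qed.

Lemma expmxE (R : realType) (n : nat) (A : 'M[R]_n) i j :
  expmx A i j = limn (series (fun k : nat => k`!%:R^-1 * (A ^+ k) i j)).
Proof.
apply/esym/cvg_lim => //.
rewrite (_ : series _ = (fun M : 'M[R]_n => M i j) \o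
    series (fun k : nat => k`!%:R^-1 *: A ^+ k)).
  by apply: cvg_comp (@expmx_cvg R n A) _; exact: coord_continuous.
apply/funext => m; rewrite /series /= summxE.
by apply: eq_bigr => k _; rewrite mxE.
Qed.

(* Normalized Laplacian, meaningful when E is simple and D-regular.  Matrices
   indexed by V are represented through the enumeration of V. *)
Definition laplacian (R : realType) (V : finType) (E : rel V) (D : nat) :
    'M[R]_#|V| :=
  \matrix_(i, j) if i == j then 1
                 else if E (enum_val i) (enum_val j) then - D%:R^-1 else 0.

Definition heat_kernel (R : realType) (V : finType) (E : rel V) (D : nat)
    (t : R) : 'M[R]_#|V| :=
  expmx ((- t) *: laplacian R E D).

Definition walk_prob (R : realType) (V : finType) (E : rel V) (D : nat)
    (x y : V) (t : R) : R :=
  heat_kernel E D t (enum_rank x) (enum_rank y).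

Definition walk_ratio (R : realType) (V : finType) (E : rel V) (D : nat)
    (u v : V) (t : R) : R :=
  walk_prob E D u v t / walk_prob E D u u t.

(* Main.v *)
Require Import Defs.
From HB Require Import structures.
From mathcomp Require Import all_boot all_order all_algebra all_fingroup.
From mathcomp Require Import all_classical all_reals all_analysis.
From mathcomp Require Import ring lra.

(** The counterexample is a lamplighter walk: a walker moves on a complete graph
    on [n = 5] positions, each carrying a lamp with [l = 2 ^ 12] values, and in
    one step either jumps to another position or changes the lamp where it
    stands.  The vertices [u] and [v] differ by the lamp at the walker's starting
    position, the origin.

    Measure time by [tau], where the walk has run for time [#|S| * tau].  The
    lamp of a position occupied for time [T] shows its initial value with
    probability [l^-1 + (1 - l^-1) * exp (- l * T)].  Expanding the product over all positions
    gives a sum over sets [B] of marked positions, whose terms are return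
    amplitudes of a walk on the complete graph killed at rate [l] on [B]
    ([walk_prob_waves]).  That walk depends on [B] only through its size and
    whether it contains the origin, and has an explicit spectral decomposition
    ([heat_wave_marked], [heat_wave_unmarked]).  Grouping the terms according to
    whether the origin is marked gives, with [q = l^-1],
      [p_uu = U + (1 - q) * N]  and  [p_uv = U - q * N]
    ([walk_prob_return], [walk_prob_toggle]), so the ratio [p_uv / p_uu]
    decreases between two times exactly when [N / U] increases ([ratio_lt]).

    Let [m] be the number of unmarked positions.  Each of them costs a factor
    [l^-1], while avoiding each marked one costs about [exp (- tau)].  In [U] the
    origin is unmarked and the walk spreads over the [m] positions, hence the
    amplitude [1 / m].  In [N] the walk has to leave the origin at once and come
    back at the very end, each at a cost of order [l^-1]; but it may do so through
    any unmarked position, hence the amplitude [m / l ^ 2].  Therefore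
    [l ^ 2 * N / U] is about the ratio of
      [sum_m m * C(n - 1, m) * x ^ m]  to  [sum_m C(n - 1, m - 1) * x ^ m / m],
    where [x = exp tau / l].  At small [x] only [m = 1] counts and the ratio is
    [n - 1 = 4]; at [x = 1] it is [32 / (31 / 5)], more than [5].  As time goes on
    the walk prefers to roam over more positions, and this favours the paths that
    never stay at the origin.  The times [tau = ln 2] and [tau = ln l] realize
    the two regimes; the inequality [marked_over_free_increases] is proved there from
    the elementary bounds on the return amplitudes. *)

Set Implicit Arguments.
Unset Strict Implicit.
Unset Printing Implicit Defensive.

Import Order.TTheory GRing.Theory Num.Theory.
Import numFieldNormedType.Exports.

Local Open Scope ring_scope.

(** * Lamplighter groups *)

(** The position component acts on lamp configurations by translation; the
    alias keeps this product law apart from the direct product. *)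
Definition wreath (L Q : finGroupType) : Type := ({ffun Q -> L} * Q)%type.

HB.instance Definition _ (L Q : finGroupType) := Finite.on (wreath L Q).

Section WreathGroup.
Variables L Q : finGroupType.
Local Open Scope group_scope.

Definition wreath_mul (g h : wreath L Q) : wreath L Q :=
  ([ffun q => g.1 q * h.1 (g.2^-1 * q)], g.2 * h.2).
Definition wreath_one : wreath L Q := ([ffun=> 1], 1).
Definition wreath_inv (g : wreath L Q) : wreath L Q :=
  ([ffun q => (g.1 (g.2 * q))^-1], g.2^-1).

Lemma wreath_mulA : associative wreath_mul.
Proof.
move=> g h k; congr pair; last exact: mulgA.
by apply/ffunP => q; rewrite !ffunE/= invMg !mulgA.
Qed.

Lemma wreath_mul1 : left_id wreath_one wreath_mul.
Proof.
case=> f x; congr pair; last exact: mul1g.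
by apply/ffunP => q; rewrite !ffunE/= invg1 !mul1g.
Qed.

Lemma wreath_mulV : left_inverse wreath_one wreath_inv wreath_mul.
Proof.
case=> f x; congr pair; last exact: mulVg.
by apply/ffunP => q; rewrite !ffunE/= invgK mulVg.
Qed.

HB.instance Definition _ :=
  Finite_isGroup.Build (wreath L Q) wreath_mulA wreath_mul1 wreath_mulV.

Definition switch (x : Q) (h : L) : wreath L Q :=
  ([ffun q => if q == x then h else 1], 1).
Definition shift (y : Q) : wreath L Q := ([ffun=> 1], y).

Definition lamp_gens : {set wreath L Q} :=
  (([set switch 1 h | h : L] :|: [set shift y | y : Q]) :\ 1)%SET.

Lemma switch1 x : switch x 1 = 1.
Proof. by congr pair; apply/ffunP => q; rewrite !ffunE; case: eqP. Qed.

Lemma mul_switch (f : {ffun Q -> L}) (x : Q) (h : L) :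
  ((f, x) : wreath L Q) * switch 1 h =
  ([ffun q => if q == x then f q * h else f q], x).
Proof.
congr pair; last exact: mulg1.
apply/ffunP => q; rewrite !ffunE/= -eq_mulVg1 eq_sym.
by case: eqP; rewrite ?mulg1.
Qed.

Lemma mul_shift (f : {ffun Q -> L}) (x y : Q) :
  ((f, x) : wreath L Q) * shift y = (f, x * y).
Proof. by congr pair; apply/ffunP => q; rewrite !ffunE mulg1. Qed.

Lemma switch_inj x : injective (switch x).
Proof. by move=> h k [] /ffunP/(_ x); rewrite !ffunE eqxx. Qed.

Lemma shift_inj : injective shift.
Proof. by move=> y z []. Qed.

Lemma switchV h : (switch 1 h)^-1 = switch 1 h^-1.
Proof.
apply/eqP; rewrite eq_invg_mul mul_switch; apply/eqP; congr pair.
by apply/ffunP => q; rewrite !ffunE; case: eqP; rewrite ?mulgV.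
Qed.

Lemma shiftV y : (shift y)^-1 = shift y^-1.
Proof. by apply/eqP; rewrite eq_invg_mul mul_shift mulgV. Qed.

(** Lamps away from the identity are reached by going there, switching, and
    coming back; hence the lamp group at the identity and the moves generate. *)
Lemma switch_conj x h : switch x h = shift x * switch 1 h * shift x^-1.
Proof.
rewrite /shift mul_switch mul_shift mulgV; congr pair.
by apply/ffunP => q; rewrite !ffunE mul1g.
Qed.

Lemma lamp_gens_cayley : cayley_set lamp_gens.
Proof.
split.
- have gen_shift y : shift y \in <<lamp_gens>>.
    have [->|y1] := eqVneq (shift y) 1; first exact: group1.
    by apply: mem_gen; rewrite !inE y1 imset_f ?orbT.
  have gen_switch x h : switch x h \in <<lamp_gens>>.
    rewrite switch_conj !groupM//.
    have [->|h1] := eqVneq (switch 1 h) 1; first exact: group1.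
    by apply: mem_gen; rewrite !inE h1 imset_f.
  apply/eqP; rewrite finset.eqEsubset finset.subsetT; apply/fintype.subsetP => -[f x] _ /=.
  have -> : ((f, x) : wreath L Q) = ((f, 1) : wreath L Q) * shift x.
    by rewrite mul_shift mul1g.
  apply: groupM => //.
  (* Light the configuration one position at a time. *)
  pose res (s : seq Q) : wreath L Q := ([ffun q => if q \in s then f q else 1], 1).
  have -> : ((f, 1) : wreath L Q) = res (enum Q).
    by congr pair; apply/ffunP => q; rewrite !ffunE mem_enum.
  elim: (enum Q) => [|q s IHs].
    suff -> : res [::] = 1 by exact: group1.
    by congr pair; apply/ffunP => q; rewrite !ffunE.
  have [qs|qNs] := boolP (q \in s).
    suff -> : res (q :: s) = res s by [].
    congr pair; apply/ffunP => r; rewrite !ffunE in_cons.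
    by case: eqP => [->|//]; rewrite qs.
  suff -> : res (q :: s) = switch q (f q) * res s by rewrite groupM.
  congr pair; last by rewrite mulg1.
  apply/ffunP => r; rewrite !ffunE/= invg1 mul1g in_cons.
  by case: eqP => [->|//]; rewrite ?(negbTE qNs) ?mulg1 ?mul1g.
- have sub : (lamp_gens^-1 \subset lamp_gens)%SET.
    apply/fintype.subsetP => g; rewrite mem_invg !inE => /andP[].
    rewrite invg_eq1 => -> /= /orP[] /imsetP[z _ gz]; apply/orP; [left|right].
      by apply/imsetP; exists z^-1 => //; rewrite -switchV -gz invgK.
    by apply/imsetP; exists z^-1 => //; rewrite -shiftV -gz invgK.
  apply/eqP; rewrite finset.eqEsubset sub /=.
  by rewrite -{1}[lamp_gens]invgK invSg.
- by rewrite !inE eqxx.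
Qed.

(** The lamp group at the identity and the group of moves meet only in the
    identity, so a summand vanishing there may be summed over each of them. *)
Lemma lamp_gens_sum (V : zmodType) (F : wreath L Q -> V) :
  F 1 = 0%R ->
  (\sum_(s in lamp_gens) F s = \sum_h F (switch 1 h) + \sum_y F (shift y))%R.
Proof.
move=> F1.
have without1 (A : {set wreath L Q}) : 1 \in A ->
    (\sum_(s in A :\ 1%g) F s = \sum_(s in A) F s)%R.
  by move=> A1; rewrite [RHS](big_setD1 _ A1) /= F1 GRing.add0r.
rewrite /lamp_gens finset.setDUl.
rewrite (eq_bigl _ _ (fun s => finset.in_setU s _ _)) bigU /=; last first.
  rewrite -setI_eq0; apply/eqP/setP => g; rewrite !inE.
  apply/negP => /andP[/andP[g1 /imsetP[h _ gh]] /andP[_ /imsetP[y _ gy]]].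
  by case/negP: g1; rewrite gy; move: gy; rewrite gh => -[_ <-].
rewrite !without1 ?big_imset//=; first last.
- by rewrite -(switch1 1) imset_f.
- by apply/imsetP; exists 1.
- by move=> h k _ _; exact: switch_inj.
- by move=> h k _ _; exact: shift_inj.
Qed.

Lemma card_lamp_gens_gt0 : (1 < #|L|)%N -> (0 < #|lamp_gens|)%N.
Proof.
rewrite -cardsT (cardsD1 1) inE ltnS => /card_gt0P[h]; rewrite !inE andbT => h1.
apply/card_gt0P; exists (switch 1 h); rewrite !inE imset_f ?andbT//.
by rewrite -(switch1 1) (inj_eq (@switch_inj _)).
Qed.
End WreathGroup.

(** * Heat flow of eigenfunctions *)

Section HeatKernel.
Local Open Scope classical_set_scope.

(** The partial sums of the matrix exponential act on an eigenvector as those of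
    the scalar one. *)
Lemma expmx_eigen (R : realType) (n : nat) (A : 'M[R]_n) (a : R)
    (phi : 'I_n -> R) :
  (forall i, \sum_j A i j * phi j = a * phi i) ->
  forall i, \sum_j expmx A i j * phi j = expR a * phi i.
Proof.
move=> Aphi i.
have powA k i0 : \sum_j (A ^+ k) i0 j * phi j = a ^+ k * phi i0.
  elim: k i0 => [|k IHk] i0.
    rewrite !expr0 mul1r (bigD1 i0)//= !mxE eqxx mul1r big1 ?addr0// => j ji.
    by rewrite mxE eq_sym (negbTE ji) mul0r.
  under eq_bigr => j _ do rewrite exprS mxE mulr_suml.
  rewrite exchange_big /=.
  under eq_bigr => p _ do
    (under eq_bigr => j _ do rewrite -mulrA; rewrite -mulr_sumr IHk mulrCA).
  by rewrite -mulr_sumr Aphi exprSr mulrA.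
have lhs : (fun m => \sum_j series (fun k => k`!%:R^-1 * (A ^+ k) i j) m * phi j)
    @ \oo --> \sum_j expmx A i j * phi j.
  apply: cvg_big => [|j _]; first exact: add_continuous.
  rewrite expmxE; apply: cvgMr_tmp; exact: expmx_entry_is_cvg.
have rhs : (fun m => series (exp_coeff a) m * phi i) @ \oo --> expR a * phi i.
  by apply: cvgMr_tmp; exact: is_cvg_series_exp_coeff.
suff eq_seq : (fun m => \sum_j series (fun k => k`!%:R^-1 * (A ^+ k) i j) m * phi j)
    = (fun m => series (exp_coeff a) m * phi i).
  by rewrite eq_seq in lhs; exact: (cvg_unique _ lhs rhs).
apply/funext => m; rewrite /series /=.
under eq_bigr => j _ do rewrite mulr_suml.
rewrite exchange_big /= mulr_suml; apply: eq_bigr => k _.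
under eq_bigr => j _ do rewrite -mulrA.
by rewrite -mulr_sumr powA /exp_coeff /= mulrA [a ^+ k / _]mulrC.
Qed.

End HeatKernel.

Section Heat.
Variables (R : realType) (gT : finGroupType) (S : {set gT}).

(** Unnormalized: [#|S|] times the normalized Laplacian, so that the number of
    generators only rescales time. *)
Definition cayley_laplacian (phi : gT -> R) (g : gT) : R :=
  \sum_(s in S) (phi g - phi (g * s)%g).

Definition heat (t : R) (phi : gT -> R) (g : gT) : R :=
  \sum_h walk_prob (cayley_edge S) #|S| g h t * phi h.

Lemma laplacian_cayley (phi : gT -> R) (g : gT) :
  1%g \notin S -> (0 < #|S|)%N ->
  \sum_j laplacian R (cayley_edge S) #|S| (enum_rank g) j * phi (enum_val j) =
  #|S|%:R^-1 * cayley_laplacian phi g.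
Proof.
move=> S1 S0.
have S0' : #|S|%:R != 0 :> R by rewrite pnatr_eq0 -lt0n.
rewrite (reindex (@enum_rank gT)) /=; last first.
  by exists enum_val => h _; rewrite ?enum_valK ?enum_rankK.
under eq_bigr => h _ do rewrite mxE !enum_rankK.
rewrite (bigD1 g)//= eqxx mul1r.
rewrite (eq_bigr (fun h => if cayley_edge S g h then - #|S|%:R^-1 * phi h else 0)); last first.
  move=> h hg; rewrite (inj_eq enum_rank_inj) eq_sym (negbTE hg).
  by case: ifP; rewrite ?mul0r.
rewrite -big_mkcondr /= (eq_bigl (fun h => h \in [set (g * s)%g | s in S]%SET)); last first.
  move=> h; apply/andP/imsetP => [[_ /exists_inP[s sS /eqP ->]]|[s sS ->]].
    by exists s.
  split; last by apply/exists_inP; exists s.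
  rewrite -{2}[g]mulg1; apply: contra S1 => /eqP/mulgI s1.
  by rewrite -s1.
rewrite big_imset /=; last by move=> s s' _ _; exact: mulgI.
rewrite -mulr_sumr mulNr /cayley_laplacian sumrB sumr_const mulrBr.
by rewrite -(mulr_natl (phi g)) mulKf.
Qed.

Lemma heat_eigen (lambda : R) (phi : gT -> R) (t : R) (g : gT) :
  1%g \notin S -> (0 < #|S|)%N ->
  (forall x, cayley_laplacian phi x = lambda * phi x) ->
  heat (#|S|%:R * t) phi g = expR (- (lambda * t)) * phi g.
Proof.
move=> S1 S0 phiE.
have S0' : #|S|%:R != 0 :> R by rewrite pnatr_eq0 -lt0n.
rewrite /heat (reindex (@enum_val gT gT)) /=; last first.
  by exists enum_rank => h _; rewrite ?enum_valK ?enum_rankK.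
under eq_bigr => j _ do rewrite /walk_prob enum_valK /heat_kernel.
rewrite -{2}[g]enum_rankK; apply: expmx_eigen => i.
under eq_bigr => j _ do rewrite mxE -mulrA.
rewrite -mulr_sumr -{1}[i]enum_valK laplacian_cayley// phiE !mulrA.
congr (_ * _); rewrite mulNr mulNr; congr (- _).
by rewrite mulrAC -(mulrA _ t) mulrC mulKf// mulrC.
Qed.

Lemma heat_sum (I : finType) (phi : I -> gT -> R) t g :
  heat t (fun h => \sum_i phi i h) g = \sum_i heat t (phi i) g.
Proof.
by rewrite /heat exchange_big; apply: eq_bigr => h _; rewrite mulr_sumr.
Qed.

Lemma eq_heat (phi psi : gT -> R) t g : phi =1 psi -> heat t phi g = heat t psi g.
Proof. by move=> phipsi; apply: eq_bigr => h _; rewrite phipsi. Qed.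

Lemma heat_lincomb3 (a b c : R) (phi psi chi : gT -> R) t g :
  heat t (fun h => a * phi h + b * psi h + c * chi h) g =
  a * heat t phi g + b * heat t psi g + c * heat t chi g.
Proof.
rewrite /heat !mulr_sumr -!big_split /=; apply: eq_bigr => h _.
by rewrite !mulrDr; congr (_ + _ + _); rewrite mulrCA.
Qed.

Lemma walk_prob_heat (u v : gT) (t : R) :
  walk_prob (cayley_edge S) #|S| u v t = heat t (fun h => (h == v)%:R) u.
Proof.
rewrite /heat (bigD1 v)//= eqxx mulr1 big1 ?addr0// => h hv.
by rewrite (negbTE hv) mulr0.
Qed.
End Heat.

(** * Rates of the killed walk on a complete graph *)

Section Rates.
Variables (R : realType) (n l b : R).

(** On functions that are constant on the [b] marked positions and constant on
    the others, the generator of the walk killed at rate [l] on the marked ones is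
    a 2 by 2 matrix with eigenvalues [slow_rate] and [fast_rate], the roots of
    [X ^ 2 - (n + l) * X + l * b]. *)
Definition rate_gap : R := Num.sqrt ((n + l) ^+ 2 - 4 * l * b).
Definition slow_rate : R := (n + l - rate_gap) / 2.
Definition fast_rate : R := (n + l + rate_gap) / 2.

(** Weight of the origin after time [tau] for the killed walk started there, when
    the origin is marked.  The last term is the part of the initial point mass that
    sums to zero over the marked positions. *)
Definition return_marked (tau : R) : R :=
  b^-1 * (((b - slow_rate) * expR (- (slow_rate * tau)) +
           (fast_rate - b) * expR (- (fast_rate * tau))) / (fast_rate - slow_rate))
  + (1 - b^-1) * expR (- ((n + l) * tau)).

(** The same weight when the origin is one of the [n - b] unmarked positions. *)
Definition return_unmarked (tau : R) : R :=
  (n - b)^-1 * (((fast_rate - b) * expR (- (slow_rate * tau)) +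
           (b - slow_rate) * expR (- (fast_rate * tau))) / (fast_rate - slow_rate))
  + (1 - (n - b)^-1) * expR (- (n * tau)).

Lemma rates_sum : slow_rate + fast_rate = n + l.
Proof. by rewrite /slow_rate /fast_rate; lra. Qed.

Hypotheses (b_ge0 : 0 <= b) (b_le_n : b <= n) (n_lt_l : n < l).

Lemma discr_ge0 : 0 <= (n + l) ^+ 2 - 4 * l * b.
Proof.
rewrite (_ : _ - _ = (l - n) ^+ 2 + 4 * (l * (n - b))); last by ring.
by rewrite addr_ge0 ?sqr_ge0// mulr_ge0// mulr_ge0//; move: b_ge0 b_le_n n_lt_l; lra.
Qed.

Lemma rates_mul : slow_rate * fast_rate = l * b.
Proof.
have := sqr_sqrtr discr_ge0; rewrite -/rate_gap => gap2.
by rewrite /slow_rate /fast_rate; move: b_ge0 b_le_n n_lt_l; lra.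
Qed.

Lemma rates_dist : (fast_rate - b) * (b - slow_rate) = b * (n - b).
Proof.
transitivity (b * (slow_rate + fast_rate) - slow_rate * fast_rate - b * b).
  by ring.
by rewrite rates_sum rates_mul; ring.
Qed.

Lemma fast_rate_ge : l <= fast_rate.
Proof.
have : l - n <= rate_gap.
  rewrite -[leLHS]ger0_norm; last by move: n_lt_l; lra.
  rewrite -sqrtr_sqr /rate_gap; apply: ler_wsqrtr.
  rewrite -subr_ge0.
  rewrite (_ : _ - _ = 4 * (l * (n - b))); last by ring.
  by rewrite mulr_ge0// mulr_ge0//; move: b_ge0 b_le_n n_lt_l; lra.
by rewrite /fast_rate; move: b_ge0 b_le_n n_lt_l; lra.
Qed.

Lemma slow_rate_le : slow_rate <= b.
Proof.
have : n + l - 2 * b <= rate_gap.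
  rewrite -[leLHS]ger0_norm; last by move: b_ge0 b_le_n n_lt_l; lra.
  rewrite -sqrtr_sqr /rate_gap; apply: ler_wsqrtr.
  rewrite -subr_ge0.
  rewrite (_ : _ - _ = 4 * (b * (n - b))); last by ring.
  by rewrite mulr_ge0// mulr_ge0//; move: b_ge0 b_le_n n_lt_l; lra.
by rewrite /slow_rate; move: b_ge0 b_le_n n_lt_l; lra.
Qed.

Lemma slow_rate_ge0 : 0 <= slow_rate.
Proof.
have f0 : 0 < fast_rate by have := fast_rate_ge; move: b_ge0 b_le_n n_lt_l; lra.
by rewrite -(pmulr_lge0 _ f0) rates_mul mulr_ge0//; move: b_ge0 b_le_n n_lt_l; lra.
Qed.

End Rates.

(** * Separation of the lamps from the position *)

Section Waves.
Variables (R : realType) (L Q : finGroupType).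
Implicit Types (B : {set Q}) (c f : {ffun Q -> L}) (psi : Q -> R).
Local Notation l := (#|L|%:R : R).

(** On unmarked positions the uniform mode of the lamp, invariant under switching;
    on marked ones the mean-zero part of the point mass at [c], which the switches
    of that lamp damp at rate [#|L|].  Both modes add up to the point mass. *)
Definition lamp_mode c B f : R :=
  \prod_q if q \in B then (f q == c q)%:R - l^-1 else l^-1.

Definition wave c B psi (g : wreath L Q) : R := psi g.2 * lamp_mode c B g.1.

Lemma card_group_neq0 (gT : finGroupType) : #|gT|%:R != 0 :> R.
Proof. by rewrite pnatr_eq0 -lt0n; apply/card_gt0P; exists 1%g. Qed.

Lemma delta_waves c x (g : wreath L Q) :
  (g == (c, x))%:R = \sum_B wave c B (fun y => (y == x)%:R) g.
Proof.
case: g => f y; rewrite /wave /= -mulr_sumr xpair_eqE andbC -mulnb natrM.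
congr (_ * _).
transitivity (\prod_q (((f q == c q)%:R - l^-1) + l^-1)).
  under eq_bigr => q _ do rewrite subrK.
  have [->|fc] := eqVneq f c; first by rewrite big1// => q _; rewrite eqxx.
  have [q fq] : exists q, f q != c q.
    apply/existsP; apply: contraNT fc => /existsPn fc.
    by apply/eqP/ffunP => q; apply/eqP; rewrite -[_ == _]negbK.
  by rewrite (bigD1 q)//= (negbTE fq) mul0r.
by rewrite bigA_distr; apply: eq_bigl => B; rewrite inE.
Qed.

Lemma lamp_mode_average c B f x :
  \sum_h lamp_mode c B [ffun q => if q == x then f q * h else f q]%g =
  (if x \in B then 0 else l) * lamp_mode c B f.
Proof.
rewrite /lamp_mode [in RHS](bigD1 x)//= mulrA.
under eq_bigr => h _.
  rewrite (bigD1 x)//= ffunE eqxx.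
  under eq_bigr => q qx do rewrite ffunE (negbTE qx).
  over.
rewrite -mulr_suml; congr (_ * _); case: ifP => xB; last first.
  by rewrite sumr_const mulr_natl.
rewrite mul0r (reindex_inj (mulgI (f x)^-1)%g) /=.
under eq_bigr => h _ do rewrite mulKVg.
rewrite sumrB (bigD1 (c x))//= eqxx big1 ?addr0; last by move=> h /negbTE ->.
by rewrite sumr_const -[l^-1 *+ _]mulr_natl mulfV ?subrr// card_group_neq0.
Qed.

(** Averaging over the switches removes the marked modes and keeps the unmarked
    ones, so on the position factor the lamplighter acts as a walk on the complete
    graph with killing on [B]. *)
Lemma wave_laplacian c B psi (g : wreath L Q) :
  cayley_laplacian (lamp_gens L Q) (wave c B psi) g =
  (\sum_y (psi g.2 - psi y) + (if g.2 \in B then l else 0) * psi g.2) *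
  lamp_mode c B g.1.
Proof.
case: g => f x; rewrite /cayley_laplacian lamp_gens_sum; last by rewrite mulg1 subrr.
under eq_bigr => h _ do rewrite mul_switch /wave /= -mulrBr.
under [X in _ + X = _]eq_bigr => y _ do rewrite mul_shift /wave /= -mulrBl.
rewrite -mulr_sumr -mulr_suml sumrB lamp_mode_average sumr_const /=.
rewrite (reindex_inj (mulgI x^-1)%g) /=.
under eq_bigr => y _ do rewrite mulKVg.
by rewrite -[_ *+ _]mulr_natl; case: ifP => _; ring.
Qed.

End Waves.

Section Spectral.
Variables (R : realType) (L Q : finGroupType).
Implicit Types (B : {set Q}) (c f : {ffun Q -> L}) (psi : Q -> R).
Local Notation l := (#|L|%:R : R).
Local Notation n := (#|Q|%:R : R).
Local Notation S := (lamp_gens L Q).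

Lemma wave_eigen c B psi lambda :
  (forall x, n * psi x - \sum_y psi y + (if x \in B then l else 0) * psi x =
             lambda * psi x) ->
  forall g, cayley_laplacian S (wave c B psi) g = lambda * wave c B psi g.
Proof.
move=> psiE g; rewrite wave_laplacian /wave mulrA -psiE sumrB sumr_const.
by rewrite mulr_natl.
Qed.

Lemma sum_delta (x : Q) : \sum_y (y == x)%:R = 1 :> R.
Proof. by rewrite (bigD1 x)//= eqxx big1 ?addr0// => y /negbTE ->. Qed.

Lemma sum_two_level B (alpha beta : R) :
  \sum_y (if y \in B then alpha else beta) =
  #|B|%:R * alpha + (n - #|B|%:R) * beta.
Proof.
rewrite (bigID (mem B)) /=.
rewrite (eq_bigr (fun=> alpha)); last by move=> y ->.
rewrite [X in _ + X](eq_bigr (fun=> beta)); last by move=> y /negbTE ->.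
have -> : n - #|B|%:R = #|[predC B]|%:R.
  by rewrite -(cardC B) natrD addrAC subrr add0r.
by rewrite !sumr_const !mulr_natl.
Qed.

Lemma two_level_eigen c B (alpha beta lambda : R) :
  (n - #|B|%:R + l - lambda) * alpha = (n - #|B|%:R) * beta ->
  (#|B|%:R - lambda) * beta = #|B|%:R * alpha ->
  forall g, cayley_laplacian S (wave c B (fun y => if y \in B then alpha else beta)) g
    = lambda * wave c B (fun y => if y \in B then alpha else beta) g.
Proof.
move=> eqB eqC; apply: wave_eigen => x; rewrite sum_two_level.
by case: ifP => _; lra.
Qed.

Section Return.
Variables (B : {set Q}) (x : Q).
Hypothesis QltL : (#|Q| < #|L|)%N.
Local Notation b := (#|B|%:R : R).

Lemma heat_eigen_wave c psi lambda tau g :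
  (forall g, cayley_laplacian S (wave c B psi) g = lambda * wave c B psi g) ->
  heat S (#|S|%:R * tau) (wave c B psi) g =
  expR (- (lambda * tau)) * wave c B psi g.
Proof.
have [_ _ S1] := lamp_gens_cayley L Q.
move=> psiE; apply: heat_eigen => //.
apply: card_lamp_gens_gt0; apply: leq_ltn_trans QltL.
by apply/card_gt0P; exists 1%g.
Qed.

Let b_ge0 : 0 <= b. Proof. exact: ler0n. Qed.
Let b_le_n : b <= n. Proof. by rewrite ler_nat max_card. Qed.
Let n_lt_l : n < l. Proof. by rewrite ltr_nat. Qed.
Local Notation slow := (slow_rate n l b).
Local Notation fast := (fast_rate n l b).

Let gap_neq0 : fast - slow != 0.
Proof.
have := fast_rate_ge b_ge0 b_le_n n_lt_l; have := slow_rate_le b_ge0 b_le_n n_lt_l.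
by move=> h1 h2; apply: lt0r_neq0; move: b_le_n n_lt_l; lra.
Qed.

(** The point mass at [x] splits into a part summing to zero over [B] and the
    uniform mass on [B], which is a difference of two two-level eigenfunctions. *)
Lemma heat_wave_marked c f tau : x \in B ->
  heat S (#|S|%:R * tau) (wave c B (fun y => (y == x)%:R)) (f, x) =
  return_marked n l b tau * lamp_mode R c B f.
Proof.
move=> xB.
have b0 : b != 0 by rewrite pnatr_eq0 -lt0n; apply/card_gt0P; exists x.
have sumr := rates_sum n l b.
have slowE : n - b + l - slow = fast - b by lra.
have fastE : n - b + l - fast = slow - b by lra.
have slow_dist := rates_dist b_ge0 b_le_n n_lt_l.
have fast_dist : (slow - b) * (b - fast) = b * (n - b) by rewrite -slow_dist; ring.
pose two alpha beta := wave c B (fun y => if y \in B then alpha else beta : R).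
pose local := wave c B (fun y => (y == x)%:R - (if y \in B then b^-1 else 0)).
have split_delta g : wave c B (fun y => (y == x)%:R) g = 1 * local g
    + (b * (fast - slow))^-1 * two (b - slow) b g
    + (- (b * (fast - slow))^-1) * two (b - fast) b g.
  rewrite /local /two /wave !mulrA -!mulrDl; congr (_ * _).
  by case: ifP => _; field; rewrite b0 gap_neq0.
rewrite (eq_heat _ _ _ split_delta) heat_lincomb3.
rewrite (@heat_eigen_wave _ _ (n + l)); last first.
  apply: wave_eigen => y; rewrite sumrB sum_delta sum_two_level mulr0 addr0.
  rewrite mulfV// subrr subr0; case: ifP => yB; first by ring.
  by rewrite eq_sym (negbTE (memPn (negbT yB) _ xB)) /=; ring.
rewrite (@heat_eigen_wave _ _ slow); last first.
  by apply: two_level_eigen; rewrite ?slowE ?slow_dist; ring.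
rewrite (@heat_eigen_wave _ _ fast); last first.
  by apply: two_level_eigen; rewrite ?fastE ?fast_dist; ring.
rewrite /local /two /wave /= eqxx xB /return_marked /=; field.
by rewrite b0 gap_neq0.
Qed.

(** As in [heat_wave_marked], with the complement of [B] in place of [B]. *)
Lemma heat_wave_unmarked c f tau : x \notin B ->
  heat S (#|S|%:R * tau) (wave c B (fun y => (y == x)%:R)) (f, x) =
  return_unmarked n l b tau * lamp_mode R c B f.
Proof.
move=> xB.
have m0 : n - b != 0.
  rewrite subr_eq0 eqr_nat neq_ltn orbC -(cardC B) -{1}(addn0 #|B|) ltn_add2l.
  by apply/orP; left; apply/card_gt0P; exists x.
have sumr := rates_sum n l b.
have slowE : n - b + l - slow = fast - b by lra.
have fastE : n - b + l - fast = slow - b by lra.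
have slow_dist := rates_dist b_ge0 b_le_n n_lt_l.
have fast_dist : (slow - b) * (b - fast) = b * (n - b) by rewrite -slow_dist; ring.
pose two alpha beta := wave c B (fun y => if y \in B then alpha else beta : R).
pose local := wave c B (fun y => (y == x)%:R - (if y \in B then 0 else (n - b)^-1)).
have split_delta g : wave c B (fun y => (y == x)%:R) g = 1 * local g
    + ((n - b) * (fast - slow))^-1 * two (n - b) (fast - b) g
    + (- ((n - b) * (fast - slow))^-1) * two (n - b) (slow - b) g.
  rewrite /local /two /wave !mulrA -!mulrDl; congr (_ * _).
  by case: ifP => _; field; rewrite m0 gap_neq0.
rewrite (eq_heat _ _ _ split_delta) heat_lincomb3.
rewrite (@heat_eigen_wave _ _ n); last first.
  apply: wave_eigen => y; rewrite sumrB sum_delta sum_two_level mulr0 add0r.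
  rewrite mulfV// subrr subr0; case: ifP => yB; last by ring.
  by rewrite (negbTE (memPn xB _ yB)) /=; ring.
rewrite (@heat_eigen_wave _ _ slow); last first.
  by apply: two_level_eigen; rewrite ?slowE -?slow_dist; ring.
rewrite (@heat_eigen_wave _ _ fast); last first.
  by apply: two_level_eigen; rewrite ?fastE -?fast_dist; ring.
rewrite /local /two /wave /= eqxx (negbTE xB) /return_unmarked /=; field.
by rewrite m0 gap_neq0.
Qed.

End Return.
End Spectral.

(** * Return probabilities of the lamplighter *)

Lemma sum_sets_avoiding (V : nmodType) (T : finType) (x : T) (F : nat -> V) :
  \sum_(B : {set T} | x \notin B) F #|B| =
  \sum_(j < #|T|) F j *+ 'C(#|T|.-1, j).
Proof.
have T0 : (0 < #|T|)%N by apply/card_gt0P; exists x.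
have card_lt (B : {set T}) : x \notin B -> (#|B| < #|T|)%N.
  move=> xB; rewrite -(cardC B) -{1}(addn0 #|B|) ltn_add2l.
  by apply/card_gt0P; exists x.
pose size_of (B : {set T}) : 'I_#|T| := insubd (Ordinal T0) #|B|.
have size_ofE (B : {set T}) : x \notin B -> size_of B = #|B| :> nat.
  by move=> xB; rewrite val_insubd card_lt.
rewrite (partition_big size_of predT)//=; apply: eq_bigr => j _.
rewrite (eq_bigr (fun=> F j)); last first.
  by move=> B /andP[xB /eqP <-]; rewrite size_ofE.
rewrite sumr_const; congr (_ *+ _).
have <- : #|[set~ x]%SET| = #|T|.-1 by rewrite cardsC1.
rewrite -cards_draws; apply: eq_card => B; rewrite [LHS]unfold_in [RHS]inE.
rewrite finset.subsetC finset.sub1set inE; apply: andb_id2l => xB.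
by rewrite -val_eqE /= size_ofE.
Qed.

(** Complementation turns the sets containing [x] into those avoiding it; [j] is
    the size of the complement. *)
Lemma sum_sets_containing (V : nmodType) (T : finType) (x : T) (F : nat -> V) :
  \sum_(B : {set T} | x \in B) F #|B| =
  \sum_(j < #|T|) F (#|T| - j)%N *+ 'C(#|T|.-1, j).
Proof.
rewrite -(sum_sets_avoiding x (fun j => F (#|T| - j)%N)).
rewrite (reindex_inj (@finset.setC_inj T)) /=.
by apply: eq_big => B => [|_]; rewrite ?inE// cardsCs finset.setCK.
Qed.

Section ReturnProbability.
Variables (R : realType) (L Q : finGroupType).
Hypotheses (Q_lt_L : (#|Q| < #|L|)%N).
Local Notation l := (#|L|%:R : R).
Local Notation n := (#|Q|%:R : R).
Local Notation S := (lamp_gens L Q).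

(** Contribution to the return probability of the marked sets that avoid the
    origin; [j] is their size. *)
Definition origin_free (k : nat) (l tau : R) : R :=
  \sum_(j < k) (1 - l^-1) ^+ j * l^-1 ^+ (k - j) * return_unmarked k%:R l j%:R tau
    *+ 'C(k.-1, j).

(** Contribution of the marked sets that contain the origin, divided by the factor
    [1 - l^-1] of the lamp at the origin; [j] is the number of unmarked
    positions. *)
Definition origin_marked (k : nat) (l tau : R) : R :=
  \sum_(j < k) (1 - l^-1) ^+ (k.-1 - j) * l^-1 ^+ j
    * return_marked k%:R l (k - j)%:R tau *+ 'C(k.-1, j).

Lemma keep_neq0 : 1 - l^-1 != 0.
Proof.
have L1 : (1 < #|L|)%N.
  by apply: leq_ltn_trans Q_lt_L; apply/card_gt0P; exists 1%g.
rewrite subr_eq0 eq_sym; suff /lt_eqF -> : l^-1 < 1 by [].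
by rewrite invf_lt1 ?ltr0n ?ltr1n// (ltn_trans _ L1).
Qed.

Lemma walk_prob_waves (f c : {ffun Q -> L}) (x : Q) (tau : R) :
  walk_prob (cayley_edge S) #|S| (f, x) (c, x) (#|S|%:R * tau) =
  \sum_(B : {set Q} | x \notin B) return_unmarked n l #|B|%:R tau * lamp_mode R c B f +
  \sum_(B : {set Q} | x \in B) return_marked n l #|B|%:R tau * lamp_mode R c B f.
Proof.
rewrite walk_prob_heat (eq_heat _ _ _ (delta_waves R c x)) heat_sum.
rewrite (bigID (fun B : {set Q} => x \notin B)) /=; congr (_ + _).
  by apply: eq_bigr => B xB; rewrite heat_wave_unmarked.
apply: eq_big => [B|B]; first by rewrite negbK.
by rewrite negbK => xB; rewrite heat_wave_marked.
Qed.

Lemma lamp_mode_diag (B : {set Q}) (f : {ffun Q -> L}) :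
  lamp_mode R f B f = (1 - l^-1) ^+ #|B| * l^-1 ^+ (#|Q| - #|B|).
Proof.
rewrite /lamp_mode (eq_bigr (fun q => if q \in B then 1 - l^-1 else l^-1)); last first.
  by move=> q _; rewrite eqxx.
rewrite (bigID (mem B)) /=.
rewrite (eq_bigr (fun=> 1 - l^-1)); last by move=> y ->.
rewrite [X in _ * X](eq_bigr (fun=> l^-1)); last by move=> y /negbTE ->.
by rewrite !prodr_const -(cardC B) addKn.
Qed.

(** Toggling the lamp at [x] only changes the factor at [x], from [1 - l^-1] to
    [- l^-1], and only when [x] is marked. *)
Lemma lamp_mode_toggle (B : {set Q}) (f c : {ffun Q -> L}) (x : Q) :
  (forall q, q != x -> f q = c q) -> f x != c x ->
  lamp_mode R c B f = if x \in B then
    - l^-1 / (1 - l^-1) * ((1 - l^-1) ^+ #|B| * l^-1 ^+ (#|Q| - #|B|))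
    else (1 - l^-1) ^+ #|B| * l^-1 ^+ (#|Q| - #|B|).
Proof.
move=> fc fcx.
have p0 := keep_neq0.
rewrite -(lamp_mode_diag _ c) /lamp_mode ![\prod_q _](bigD1 x)//= (negbTE fcx) eqxx.
have -> : \prod_(q | q != x) (if q \in B then (f q == c q)%:R - l^-1 else l^-1) =
   \prod_(q | q != x) (if q \in B then (c q == c q)%:R - l^-1 else l^-1).
  by apply: eq_bigr => q qx; rewrite fc.
by case: ifP => // _; rewrite mulrA divfK// sub0r.
Qed.

Lemma origin_markedE (x : Q) (tau : R) : origin_marked #|Q| l tau =
  (1 - l^-1)^-1 * \sum_(B : {set Q} | x \in B) return_marked n l #|B|%:R tau *
     ((1 - l^-1) ^+ #|B| * l^-1 ^+ (#|Q| - #|B|)).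
Proof.
have p0 := keep_neq0.
rewrite (sum_sets_containing x (fun b => return_marked n l b%:R tau *
     ((1 - l^-1) ^+ b * l^-1 ^+ (#|Q| - b)))) mulr_sumr.
apply: eq_bigr => j _; rewrite mulrnAr; congr (_ *+ _).
have jQ := ltn_ord j.
rewrite subKn ?(ltnW jQ)// (_ : (#|Q| - j)%N = (#|Q|.-1 - j).+1); last first.
  by move: (nat_of_ord j) jQ; case: #|Q| => // k i ik; rewrite subSn.
by rewrite exprS [RHS]mulrCA -[_ * _ * l^-1 ^+ _]mulrA mulKf// [LHS]mulrC.
Qed.

Lemma origin_freeE (x : Q) (tau : R) : origin_free #|Q| l tau =
  \sum_(B : {set Q} | x \notin B) return_unmarked n l #|B|%:R tau *
     ((1 - l^-1) ^+ #|B| * l^-1 ^+ (#|Q| - #|B|)).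
Proof.
rewrite (sum_sets_avoiding x (fun b => return_unmarked n l b%:R tau *
     ((1 - l^-1) ^+ b * l^-1 ^+ (#|Q| - b)))).
by apply: eq_bigr => j _; congr (_ *+ _); rewrite [RHS]mulrC.
Qed.

Lemma walk_prob_return tau (f : {ffun Q -> L}) (x : Q) :
  walk_prob (cayley_edge S) #|S| (f, x) (f, x) (#|S|%:R * tau) =
  origin_free #|Q| l tau + (1 - l^-1) * origin_marked #|Q| l tau.
Proof.
rewrite walk_prob_waves (origin_freeE x) (origin_markedE x) mulVKf ?keep_neq0//.
by congr (_ + _); apply: eq_bigr => B _; rewrite lamp_mode_diag.
Qed.

Lemma walk_prob_toggle tau (f c : {ffun Q -> L}) (x : Q) :
  (forall q, q != x -> f q = c q) -> f x != c x ->
  walk_prob (cayley_edge S) #|S| (f, x) (c, x) (#|S|%:R * tau) =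
  origin_free #|Q| l tau - l^-1 * origin_marked #|Q| l tau.
Proof.
move=> fc fcx; rewrite walk_prob_waves (origin_freeE x) (origin_markedE x).
rewrite -mulNr mulrA mulr_sumr; congr (_ + _); apply: eq_bigr => B xB.
  by rewrite (lamp_mode_toggle _ fc fcx) (negbTE xB).
by rewrite (lamp_mode_toggle _ fc fcx) xB mulrCA.
Qed.
End ReturnProbability.

(** * Bounds on the return amplitudes *)

Section ReturnBounds.
Variables (R : realType) (n l b tau : R).
Hypotheses (b_ge0 : 0 <= b) (b_le_n : b <= n) (n_lt_l : n < l) (tau_ge0 : 0 <= tau).
Local Notation slow := (slow_rate n l b).
Local Notation fast := (fast_rate n l b).

Let slow0 : 0 <= slow. Proof. exact: slow_rate_ge0. Qed.
Let slowb : slow <= b. Proof. exact: slow_rate_le. Qed.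
Let lfast : l <= fast. Proof. exact: fast_rate_ge. Qed.
Let sum_rates := rates_sum n l b.
Let dist_rates := rates_dist b_ge0 b_le_n n_lt_l.

Lemma slow_dist_le : b - slow <= b * (n - b) / (l - n).
Proof.
move: slow0 slowb lfast b_ge0 b_le_n n_lt_l dist_rates => s0 sb lf b0 bn nl dist.
rewrite ler_pdivlMr ?subr_gt0// -dist [leRHS]mulrC ler_wpM2l//; lra.
Qed.

Lemma slow_dist_ge : b * (n - b) / (n + l) <= b - slow.
Proof.
move: slow0 slowb lfast b_ge0 b_le_n n_lt_l dist_rates sum_rates => s0 sb lf b0 bn nl dist sum.
rewrite ler_pdivrMr -?dist; last by lra.
by rewrite mulrC ler_wpM2l//; lra.
Qed.

(** The slow rate is nearly [b], the rate of hitting the marked positions: the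
    difference costs a factor that is close to [1] while [n ^ 2 * tau] is small
    compared with [l]. *)
Lemma slow_decay_le :
  (1 - n ^+ 2 / (l - n) * tau) * expR (- (slow * tau)) <= expR (- (b * tau)).
Proof.
move: slow0 slowb lfast b_ge0 b_le_n n_lt_l slow_dist_le => s0 sb lf b0 bn nl dist.
have -> : - (b * tau) = - ((b - slow) * tau) + - (slow * tau) by ring.
rewrite expRD ler_wpM2r ?expR_ge0// (le_trans _ (expR_ge1Dx _))//.
rewrite lerD2l lerN2 ler_wpM2r// (le_trans dist)// ler_wpM2r ?invr_ge0//; first lra.
by rewrite expr2 ler_pM//; lra.
Qed.

(** About [(n - b) / l ^ 2] is the weight of a single marked position in the slow
    eigenfunction, which lives mostly on the unmarked ones.  The other terms are
    nonnegative. *)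
Lemma return_marked_ge : 1 <= b ->
  (n - b) / (n + l) ^+ 2 * expR (- (b * tau)) <= return_marked n l b tau.
Proof.
move: slow0 slowb lfast b_ge0 b_le_n n_lt_l slow_dist_ge sum_rates
  => s0 sb lf b0 bn nl dist sum b1.
have bi1 : b^-1 <= 1 by rewrite invf_le1//; lra.
have bi0 : 0 <= b^-1 by rewrite invr_ge0.
have gap0 : 0 < fast - slow by lra.
have es : expR (- (b * tau)) <= expR (- (slow * tau)).
  by rewrite ler_expR lerN2 ler_wpM2r.
rewrite /return_marked -[leLHS]addr0 lerD//; last first.
  by rewrite mulr_ge0 ?expR_ge0 ?subr_ge0.
have -> : (n - b) / (n + l) ^+ 2 * expR (- (b * tau)) =
    b^-1 * ((b * (n - b) / (n + l)) * expR (- (b * tau)) / (n + l)).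
  by field; apply/andP; split; apply: lt0r_neq0; lra.
rewrite ler_wpM2l// ler_pM ?invr_ge0//.
- by rewrite !mulr_ge0 ?expR_ge0 ?invr_ge0//; lra.
- by lra.
- rewrite -[leLHS]addr0 lerD//; last by rewrite mulr_ge0 ?expR_ge0//; lra.
  by rewrite ler_pM ?expR_ge0// !mulr_ge0 ?invr_ge0//; lra.
- by rewrite lef_pV2 ?posrE//; lra.
Qed.

Lemma return_marked_le : 1 <= b ->
  return_marked n l b tau <=
  (n - b) / (l - n) ^+ 2 * expR (- (slow * tau)) + expR (- (l * tau)).
Proof.
move: slow0 slowb lfast b_ge0 b_le_n n_lt_l slow_dist_le sum_rates
  => s0 sb lf b0 bn nl dist sum b1.
have bi1 : b^-1 <= 1 by rewrite invf_le1//; lra.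
have bi0 : 0 <= b^-1 by rewrite invr_ge0.
have gap0 : 0 < fast - slow by lra.
have ef : expR (- (fast * tau)) <= expR (- (l * tau)).
  by rewrite ler_expR lerN2 ler_wpM2r.
have en : expR (- ((n + l) * tau)) <= expR (- (l * tau)).
  by rewrite ler_expR lerN2 ler_wpM2r//; lra.
have slow_part : b^-1 * ((b - slow) * expR (- (slow * tau)) / (fast - slow)) <=
    (n - b) / (l - n) ^+ 2 * expR (- (slow * tau)).
  have -> : (n - b) / (l - n) ^+ 2 * expR (- (slow * tau)) =
      b^-1 * ((b * (n - b) / (l - n)) * expR (- (slow * tau)) / (l - n)).
    by field; apply/andP; split; apply: lt0r_neq0; lra.
  rewrite ler_wpM2l// ler_pM ?invr_ge0//.
  - by rewrite mulr_ge0 ?expR_ge0//; lra.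
  - by lra.
  - by rewrite ler_wpM2r ?expR_ge0.
  - by rewrite lef_pV2 ?posrE//; lra.
have fast_part : b^-1 * ((fast - b) * expR (- (fast * tau)) / (fast - slow)) <=
    b^-1 * expR (- (l * tau)).
  rewrite ler_wpM2l// ler_pdivrMr// mulrC ler_pM ?expR_ge0//; lra.
have tail : (1 - b^-1) * expR (- ((n + l) * tau)) <= (1 - b^-1) * expR (- (l * tau)).
  by rewrite ler_wpM2l ?subr_ge0.
rewrite /return_marked mulrDl mulrDr; lra.
Qed.

Lemma return_unmarked_ge : 1 <= n - b ->
  (l - n) / (l + n) / (n - b) * expR (- (b * tau)) <= return_unmarked n l b tau.
Proof.
move: slow0 slowb lfast b_ge0 b_le_n n_lt_l sum_rates => s0 sb lf b0 bn nl sum m1.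
have mi1 : (n - b)^-1 <= 1 by rewrite invf_le1//; lra.
have mi0 : 0 <= (n - b)^-1 by rewrite invr_ge0; lra.
have gap0 : 0 < fast - slow by lra.
have es : expR (- (b * tau)) <= expR (- (slow * tau)).
  by rewrite ler_expR lerN2 ler_wpM2r.
rewrite /return_unmarked -[leLHS]addr0 lerD//; last first.
  by rewrite mulr_ge0 ?expR_ge0 ?subr_ge0.
have -> : (l - n) / (l + n) / (n - b) * expR (- (b * tau)) =
  (n - b)^-1 * ((l - n) * expR (- (b * tau)) / (l + n)) by ring.
rewrite ler_wpM2l// ler_pM ?invr_ge0//.
- by rewrite mulr_ge0 ?expR_ge0//; lra.
- by lra.
- rewrite -[leLHS]addr0 lerD//; last by rewrite mulr_ge0 ?expR_ge0//; lra.
  by rewrite ler_pM ?expR_ge0//; lra.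
- by rewrite lef_pV2 ?posrE//; lra.
Qed.

Lemma return_unmarked_le : 1 <= n - b ->
  return_unmarked n l b tau <=
  (n - b)^-1 * expR (- (slow * tau)) + expR (- (n * tau)).
Proof.
move: slow0 slowb lfast b_ge0 b_le_n n_lt_l sum_rates => s0 sb lf b0 bn nl sum m1.
have mi0 : 0 <= (n - b)^-1 by rewrite invr_ge0; lra.
have gap0 : 0 < fast - slow by lra.
have ef : expR (- (fast * tau)) <= expR (- (slow * tau)).
  by rewrite ler_expR lerN2 ler_wpM2r//; lra.
rewrite /return_unmarked lerD//.
  rewrite ler_wpM2l// ler_pdivrMr//.
  have : (b - slow) * expR (- (fast * tau)) <= (b - slow) * expR (- (slow * tau)).
    by rewrite ler_wpM2l// subr_ge0.
  by lra.
by rewrite ler_piMl ?expR_ge0//; lra.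
Qed.

Lemma return_unmarked_ge0 : 1 <= n - b -> 0 <= return_unmarked n l b tau.
Proof.
move=> m1; apply: le_trans (return_unmarked_ge m1).
move: b_ge0 b_le_n n_lt_l => b0 bn nl.
by rewrite !mulr_ge0 ?expR_ge0 ?invr_ge0//; lra.
Qed.

Lemma return_marked_ge0 : 1 <= b -> 0 <= return_marked n l b tau.
Proof.
move=> b1; apply: le_trans (return_marked_ge b1).
move: b_ge0 b_le_n n_lt_l => b0 bn nl.
by rewrite !mulr_ge0 ?expR_ge0 ?invr_ge0 ?exprn_ge0//; lra.
Qed.

End ReturnBounds.

Section OriginNonneg.
Variables (R : realType) (k : nat) (l tau : R).
Hypotheses (l_ge1 : 1 <= l) (k_lt_l : k%:R < l) (tau_ge0 : 0 <= tau).

Let keep_ge0 : 0 <= 1 - l^-1.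
Proof. by rewrite subr_ge0 invf_le1//; move: l_ge1; lra. Qed.

Let inv_ge0 : 0 <= l^-1.
Proof. by rewrite invr_ge0; move: l_ge1; lra. Qed.

Lemma origin_free_ge0 : 0 <= origin_free k l tau.
Proof.
apply: sumr_ge0 => -[j jk] _ /=; rewrite mulrn_wge0// !mulr_ge0 ?exprn_ge0//.
by apply: return_unmarked_ge0; rewrite ?ler0n ?ler_nat ?(ltnW jk)// -natrB ?ler1n ?subn_gt0// ltnW.
Qed.

Lemma origin_marked_ge0 : 0 <= origin_marked k l tau.
Proof.
apply: sumr_ge0 => -[j jk] _ /=; rewrite mulrn_wge0// !mulr_ge0 ?exprn_ge0//.
by apply: return_marked_ge0; rewrite ?ler0n ?ler_nat ?leq_subr ?ler1n ?subn_gt0.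
Qed.
End OriginNonneg.

(** * Comparison of two times *)

Lemma sum_binomial4 (R : nzRingType) (F : nat -> R) :
  \sum_(j < 5) F j *+ 'C(4, j) =
  F 0%N + F 1%N *+ 4 + F 2%N *+ 6 + F 3%N *+ 4 + F 4%N.
Proof. by rewrite !big_ord_recr big_ord0 /= add0r. Qed.

(** The numerical constants below only need to be loose: for [l] infinite the exact
    ratios would be [4 * q ^ 2] at the early time and [160 / 31 * q ^ 2] at the late
    one, and the bounds lose little more than a tenth. *)
Section TwoTimes.
Variables (R : realType) (l : R).
Hypothesis lE : l = 2 ^+ 12.
Local Notation q := (l^-1).
Let early : R := ln 2.
(* That is [ln l], so that avoiding one marked position costs a factor [q]. *)
Let late : R := ln 2 *+ 12.

Let l_big : 4000 <= l. Proof. by rewrite lE; lra. Qed.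
Let q_gt0 : 0 < q. Proof. by rewrite invr_gt0 lE exprn_gt0. Qed.
Let ql : l * q = 1. Proof. by rewrite mulfV// lE expf_neq0. Qed.
Let qE : q = (2^-1) ^+ 12. Proof. by rewrite lE exprVn. Qed.
Let q_small : q <= 1 / 4000.
Proof.
rewrite -[leLHS]mul1r ler_pdivrMr; move: l_big; lra.
Qed.

Let ln2_ge0 : 0 <= ln 2 :> R. Proof. by rewrite ln_ge0//; lra. Qed.
Let ln2_le1 : ln 2 <= 1 :> R.
Proof. by rewrite (_ : 2 = 1 + 1)// le_ln1Dx//; lra. Qed.
Let late_ge0 : 0 <= late. Proof. exact: mulrn_wge0. Qed.

Let expR_early (j : nat) : expR (- (j%:R * early)) = 2^-1 ^+ j.
Proof. by rewrite -mulrN expRM_natl expRN lnK// posrE. Qed.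

Let expR_late (j : nat) : expR (- (j%:R * late)) = q ^+ j.
Proof.
rewrite -mulrN expRM_natl; congr (_ ^+ _).
by rewrite /late -mulNrn -[(- ln 2) *+ 12]mulr_natl expRM_natl expRN lnK ?posrE// qE.
Qed.

Lemma inv_sub5_le : (l - 5)^-1 <= 101 / 100 * q.
Proof.
move: q_gt0 ql q_small l_big => q0 ql1 qs lb.
rewrite -[leLHS]mul1r ler_pdivrMr; last by lra.
by lra.
Qed.

Lemma inv_add5_ge : 99 / 100 * q <= (l + 5)^-1.
Proof.
move: q_gt0 ql q_small l_big => q0 ql1 qs lb.
rewrite -[leRHS]mul1r ler_pdivlMr; last by lra.
by lra.
Qed.

Lemma slow_decay_early (b : nat) : (b <= 5)%N ->
  expR (- (slow_rate 5 l b%:R * early)) <= 103 / 100 * 2^-1 ^+ b.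
Proof.
move: q_small l_big ln2_ge0 ln2_le1 inv_sub5_le => qs lb ln0 ln1 il b5.
have b5' : b%:R <= 5 :> R by rewrite ler_nat.
have := @slow_decay_le R 5 l b%:R early (ler0n _ _) b5' _ ln0.
rewrite expR_early => /(_ ltac:(lra)) decay.
have small : 5 ^+ 2 / (l - 5) * early <= 26 / 1000.
  rewrite (le_trans (_ : _ <= 5 ^+ 2 / (l - 5) * 1))//; last by lra.
  by rewrite ler_wpM2l// mulr_ge0 ?invr_ge0//; lra.
have := expR_ge0 (- (slow_rate 5 l b%:R * early)); nra.
Qed.

Lemma slow_decay_late (b : nat) : (b <= 5)%N ->
  expR (- (slow_rate 5 l b%:R * late)) <= 109 / 100 * q ^+ b.
Proof.
move: q_small l_big late_ge0 ln2_le1 inv_sub5_le => qs lb late0 ln1 il b5.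
have b5' : b%:R <= 5 :> R by rewrite ler_nat.
have := @slow_decay_le R 5 l b%:R late (ler0n _ _) b5' _ late0.
rewrite expR_late => /(_ ltac:(lra)) decay.
have small : 5 ^+ 2 / (l - 5) * late <= 76 / 1000.
  rewrite (le_trans (_ : _ <= 5 ^+ 2 / (l - 5) * 12))//; last by lra.
  by rewrite ler_wpM2l// ?mulr_ge0 ?invr_ge0// /late; lra.
have := expR_ge0 (- (slow_rate 5 l b%:R * late)); nra.
Qed.

Let pow_q_ge0 j : 0 <= q ^+ j. Proof. by rewrite exprn_ge0// ltW. Qed.
Let pow_q_small j : q ^+ j.+1 <= 1 / 4000 * q ^+ j.
Proof. by rewrite exprS ler_wpM2r. Qed.
Let keep_ge0 : 0 <= 1 - q. Proof. by move: q_small; lra. Qed.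
Let keep_le1 : 1 - q <= 1. Proof. by move: q_gt0; lra. Qed.

Let pow_keep_ge (j : nat) : (j <= 4)%N -> 99 / 100 <= (1 - q) ^+ j.
Proof.
move=> j4; apply: (@le_trans _ _ ((1 - q) ^+ 4)); last exact: ler_wiXn2l.
rewrite (_ : _ ^+ 4 = 1 - 4 * q + q ^+ 2 * (6 - 4 * q + q ^+ 2)); last by ring.
have : 0 <= q ^+ 2 * (6 - 4 * q + q ^+ 2).
  by rewrite mulr_ge0 ?sqr_ge0// addr_ge0 ?sqr_ge0//; move: q_small; lra.
by move: q_small; lra.
Qed.

Let pow_keep_le1 (j : nat) : (1 - q) ^+ j <= 1.
Proof. exact: exprn_ile1. Qed.

Let lt5l : 5 < l. Proof. by move: l_big; lra. Qed.

Let natr_sub5 (j : nat) : (j <= 5)%N -> (5 - j)%:R = 5 - j%:R :> R.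
Proof. exact: natrB. Qed.

Let sub5K (j : nat) : (j <= 5)%N -> 5 - (5 - j)%:R = j%:R :> R.
Proof. by move=> j5; rewrite natr_sub5// opprB addrCA subrr addr0. Qed.

Let expR_full_early : expR (- (l * early)) <= q ^+ 5.
Proof.
rewrite {1}lE -natrX expR_early qE -exprM.
by apply: ler_wiXn2l => //; rewrite ?invr_ge0// invf_le1//; lra.
Qed.

Lemma marked_early_le : origin_marked 5 l early <= 43 / 160 * q ^+ 3.
Proof.
pose F j : R := q ^+ j *
  (j%:R * (103 / 100 * q ^+ 2) * (103 / 100 * 2^-1 ^+ (5 - j)) + q ^+ 5).
apply: (@le_trans _ _ (\sum_(j < 5) F j *+ 'C(4, j))).
  apply: ler_sum => -[j j5] _ /=; rewrite lerMn2r; apply/orP; right.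
  have b1 : 1 <= (5 - j)%:R :> R by rewrite ler1n subn_gt0.
  have b5 : (5 - j)%:R <= 5 :> R by rewrite ler_nat leq_subr.
  have j0 := ler0n R j.
  have M0 := return_marked_ge0 (ler0n _ _) b5 lt5l ln2_ge0 b1.
  have := return_marked_le (ler0n _ _) b5 lt5l ln2_ge0 b1.
  rewrite sub5K ?(ltnW j5)// => M_le.
  rewrite -mulrA (le_trans (ler_piMl _ (pow_keep_le1 _)))//.
    by rewrite mulr_ge0.
  rewrite ler_wpM2l// (le_trans M_le)// lerD//.
  apply: ler_pM; rewrite ?expR_ge0 ?slow_decay_early ?leq_subr//.
    by rewrite mulr_ge0 ?invr_ge0 ?exprn_ge0//; move: lt5l; lra.
  rewrite ler_wpM2l// -exprVn.
  apply: (@le_trans _ _ ((101 / 100 * q) ^+ 2)).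
    by rewrite lerXn2r ?nnegrE ?inv_sub5_le// ?invr_ge0 ?mulr_ge0//; move: lt5l q_gt0; lra.
  by rewrite exprMn ler_wpM2r//; lra.
rewrite sum_binomial4 /F.
have small := pow_q_small.
have := small 3%N; have := small 4%N; have := small 5%N; have := small 6%N.
have := small 7%N; have := small 8%N; have := pow_q_ge0 3.
by rewrite /= !expr0 !expr1 => *; lra.
Qed.

(** Among the walks that contribute at the early time, those that have never left
    the origin dominate, so the marked sets of size four suffice. *)
Lemma free_early_ge : 97 / 1600 * q <= origin_free 5 l early.
Proof.
rewrite /origin_free big_ord_recr /= -[leLHS]add0r lerD//.
  apply: sumr_ge0 => -[j j4] _ /=; rewrite mulrn_wge0//.
  have b5 : j%:R <= 5 :> R by rewrite ler_nat ltnW// ltnW.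
  have b1 : 1 <= 5 - j%:R :> R.
    by have : j%:R <= 4 :> R; [rewrite ler_nat ltnW | lra].
  rewrite mulr_ge0//; first by rewrite mulr_ge0 ?pow_q_ge0 ?exprn_ge0.
  exact: (return_unmarked_ge0 (ler0n _ _) b5 lt5l ln2_ge0 b1).
have b5 : 4%:R <= 5 :> R by lra.
have b1 : 1 <= 5 - 4%:R :> R by lra.
have := return_unmarked_ge (ler0n _ _) b5 lt5l ln2_ge0 b1.
rewrite expR_early => U_ge; have p4 := @pow_keep_ge 4 isT.
have ratio : 98 / 100 <= (l - 5) / (l + 5).
  apply: (@le_trans _ _ ((l - 5) * (99 / 100 * q))).
    by move: q_small ql; lra.
  by rewrite ler_wpM2l ?inv_add5_ge//; move: lt5l; lra.
have U4 : 98 / 1600 <= return_unmarked 5 l 4 early.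
  apply: le_trans U_ge; rewrite (_ : 5 - 4 = 1 :> R) ?divr1; last by lra.
  by move: ratio; move: ((l - 5) / (l + 5)) => r; lra.
rewrite expr1 mulr1n (le_trans (_ : _ <= 99 / 100 * q * (98 / 1600)))//.
  by move: q_gt0; lra.
apply: ler_pM U4; [|by lra|by rewrite ler_wpM2r// ltW].
by rewrite mulr_ge0 ?(ltW q_gt0).
Qed.

Lemma marked_late_ge : 31 * q ^+ 7 <= origin_marked 5 l late.
Proof.
pose F j : R := 99 / 100 * q ^+ j * (j%:R * (98 / 100 * q ^+ 2) * q ^+ (5 - j)).
apply: (@le_trans _ _ (\sum_(j < 5) F j *+ 'C(4, j))).
  rewrite sum_binomial4 /F /= !expr0 !expr1.
  have := pow_q_ge0 7; lra.
apply: ler_sum => -[j j5] _ /=; rewrite lerMn2r; apply/orP; right.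
have b1 : 1 <= (5 - j)%:R :> R by rewrite ler1n subn_gt0.
have b5 : (5 - j)%:R <= 5 :> R by rewrite ler_nat leq_subr.
have j0 := ler0n R j.
have := return_marked_ge (ler0n _ _) b5 lt5l late_ge0 b1.
rewrite expR_late sub5K ?(ltnW j5)// => M_ge.
apply: ler_pM.
- by have := pow_q_ge0 j; lra.
- by rewrite mulr_ge0// mulr_ge0//; have := pow_q_ge0 2; lra.
- by rewrite ler_wpM2r// pow_keep_ge// leq_subr.
apply: le_trans M_ge; rewrite ler_wpM2r// ler_wpM2l// -exprVn addrC.
apply: (@le_trans _ _ ((99 / 100 * q) ^+ 2)).
  by rewrite exprMn ler_wpM2r//; lra.
by rewrite lerXn2r ?nnegrE ?inv_add5_ge// ?invr_ge0 ?mulr_ge0//; move: lt5l q_gt0; lra.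
Qed.

Lemma free_late_le : origin_free 5 l late <= 68 / 10 * q ^+ 5.
Proof.
pose F j : R := q ^+ (5 - j) * ((5 - j)%:R^-1 * (109 / 100 * q ^+ j) + q ^+ 5).
apply: (@le_trans _ _ (\sum_(j < 5) F j *+ 'C(4, j))).
  apply: ler_sum => -[j j5] _ /=; rewrite lerMn2r; apply/orP; right.
  have b5 : j%:R <= 5 :> R by rewrite ler_nat ltnW.
  have b1 : 1 <= 5 - j%:R :> R by rewrite -natr_sub5 1?ltnW// ler1n subn_gt0.
  have U0 := return_unmarked_ge0 (ler0n _ _) b5 lt5l late_ge0 b1.
  have := return_unmarked_le (ler0n _ _) b5 lt5l late_ge0 b1.
  rewrite (expR_late 5) => U_le.
  rewrite -mulrA (le_trans (ler_piMl _ (pow_keep_le1 _)))//.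
    by rewrite mulr_ge0.
  rewrite ler_wpM2l// (le_trans U_le)// lerD2r natr_sub5 1?ltnW// ler_wpM2l//.
    by rewrite invr_ge0; lra.
  by rewrite slow_decay_late// ltnW.
rewrite sum_binomial4 /F.
have small := pow_q_small.
have := small 5%N; have := small 6%N.
have := small 7%N; have := small 8%N; have := small 9%N; have := pow_q_ge0 5.
rewrite -[(5 - 0)%N]/5%N -[(5 - 1)%N]/4%N -[(5 - 2)%N]/3%N -[(5 - 3)%N]/2%N.
by rewrite -[(5 - 4)%N]/1%N !expr0 !expr1 => *; lra.
Qed.

Lemma marked_over_free_increases :
  origin_marked 5 l early * origin_free 5 l late <
  origin_marked 5 l late * origin_free 5 l early.
Proof.
have l_ge1 : 1 <= l by move: l_big; lra.
have M1 := origin_marked_ge0 (k := 5) l_ge1 lt5l ln2_ge0.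
have U2 := origin_free_ge0 (k := 5) l_ge1 lt5l late_ge0.
apply: (@le_lt_trans _ _ ((43 / 160 * q ^+ 3) * (68 / 10 * q ^+ 5))).
  by rewrite ler_pM ?marked_early_le ?free_late_le.
apply: (@lt_le_trans _ _ ((31 * q ^+ 7) * (97 / 1600 * q))); last first.
  apply: ler_pM marked_late_ge free_early_ge; last by move: q_gt0; lra.
  by have := pow_q_ge0 7; lra.
have : 0 < q ^+ 8 by rewrite exprn_gt0.
by lra.
Qed.
End TwoTimes.

(** * The counterexample *)

(** After clearing denominators the two sides differ by [N2 * U1 - N1 * U2]. *)
Lemma ratio_lt (R : realFieldType) (q U1 N1 U2 N2 : R) :
  0 < U1 + (1 - q) * N1 -> 0 < U2 + (1 - q) * N2 -> N1 * U2 < N2 * U1 ->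
  (U2 - q * N2) / (U2 + (1 - q) * N2) < (U1 - q * N1) / (U1 + (1 - q) * N1).
Proof.
move=> D1 D2 drop.
by rewrite ltr_pdivrMr// mulrAC ltr_pdivlMr//; lra.
Qed.

Lemma finGroup_of_card (k : nat) : (0 < k)%N -> exists L : finGroupType, #|L| = k.
Proof. by case: k => // k _; exists 'I_k.+1; rewrite card_ord. Qed.

Lemma lamplighter_drop (R : realType) (L Q : finGroupType) (h : L) :
  #|Q| = 5%N -> #|L| = (2 ^ 12)%N -> h != 1%g ->
  walk_ratio (cayley_edge (lamp_gens L Q)) #|lamp_gens L Q| 1%g (switch 1%g h)
    (#|lamp_gens L Q|%:R * (ln 2 *+ 12) : R) <
  walk_ratio (cayley_edge (lamp_gens L Q)) #|lamp_gens L Q| 1%g (switch 1%g h)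
    (#|lamp_gens L Q|%:R * ln 2 : R).
Proof.
move=> Q5 L12 h1.
have lE : #|L|%:R = 2 ^+ 12 :> R by rewrite L12 natrX.
have Q_lt_L : (#|Q| < #|L|)%N by rewrite Q5 L12 (@leq_trans (2 ^ 3)) ?leq_exp2l.
pose c : {ffun Q -> L} := [ffun q => if q == 1%g then h else 1%g].
have toggled (q : Q) : q != 1%g -> [ffun=> 1%g] q = c q.
  by move=> q1; rewrite !ffunE (negbTE q1).
have toggled1 : [ffun=> 1%g] (1%g : Q) != c 1%g.
  by rewrite !ffunE eqxx eq_sym.
rewrite /walk_ratio !(walk_prob_toggle Q_lt_L _ toggled toggled1).
rewrite !(walk_prob_return Q_lt_L) Q5.
have l_big : 4000 <= #|L|%:R :> R by rewrite lE; lra.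
have q0 : 0 < (#|L|%:R : R)^-1 by rewrite invr_gt0; lra.
have q1 : 0 < 1 - (#|L|%:R : R)^-1.
  by rewrite subr_gt0 invf_lt1; lra.
have l5 : 5%:R < #|L|%:R :> R by lra.
have l1 : 1 <= #|L|%:R :> R by lra.
have early0 : 0 <= ln 2 :> R by rewrite ln_ge0//; lra.
have late0 : 0 <= ln 2 *+ 12 :> R by rewrite mulrn_wge0.
apply: ratio_lt; last exact: marked_over_free_increases lE.
- rewrite ltr_pwDl//; last by rewrite mulr_ge0 ?(ltW q1) ?origin_marked_ge0.
  by apply: lt_le_trans (free_early_ge lE); move: q0; clear; lra.
- rewrite ltr_wpDl//; first exact: origin_free_ge0.
  rewrite mulr_gt0//; apply: lt_le_trans (marked_late_ge lE).
  by move: (exprn_gt0 7 q0); clear; lra.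
Qed.

Theorem theorem1p1 (R : realType) :
  exists (gT : finGroupType) (S : {set gT}) (u v : gT),
    cayley_set S /\
    exists t1 t2 : R, [/\ 0 <= t1, t1 < t2 &
      walk_ratio (cayley_edge S) #|S| u v t2 <
      walk_ratio (cayley_edge S) #|S| u v t1].
Proof.
have [Q Q5] := @finGroup_of_card 5 isT.
have [L L12] : exists L : finGroupType, #|L| = (2 ^ 12)%N.
  by apply: finGroup_of_card; rewrite expn_gt0.
have L_gt1 : (1 < #|L|)%N by rewrite L12 (@leq_trans (2 ^ 1)) ?leq_exp2l.
have [h h1] : exists h : L, h != 1%g.
  move: L_gt1; rewrite -cardsT (cardsD1 1%g) inE ltnS => /card_gt0P[h].
  by rewrite !inE andbT => h1; exists h.
exists (wreath L Q), (lamp_gens L Q), 1%g, (switch 1%g h).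
split; first exact: lamp_gens_cayley.
exists (#|lamp_gens L Q|%:R * ln 2), (#|lamp_gens L Q|%:R * (ln 2 *+ 12)).
have ln2_gt0 : 0 < ln 2 :> R by rewrite ln_gt0//; lra.
split; last exact: lamplighter_drop.
- by rewrite mulr_ge0// ltW.
- by rewrite ltr_pM2l ?ltr0n ?card_lamp_gens_gt0// -[ltLHS]mulr1n ltr_pMn2l.
Qed.
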